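(* Let $N\in\mathbb{N}$ and let $s_0=1,s_1,\ldots,s_{2N-2}$ be real numbers. There exists an $N\times N$ Jacobi matrix $A^N$ whose spectral measure $d\rho^N$ (Dirichlet boundary condition at $n=N+1$) satisfies $s_k=\int_{-\infty}^\infty\lambda^k\,d\rho^N(\lambda)$ for $k=0,1,\ldots,2N-2$ if and only if the matrix $S^N_0$ is positive definite.
   Context: An $N\times N$ Jacobi matrix $A^N$ is a real symmetric tridiagonal matrix with diagonal $b_1,\ldots,b_N\in\mathbb{R}$ and off-diagonal entries $a_1,\ldots,a_{N-1}>0$; set $a_0=1$. It corresponds to the difference expression $a_n\psi_{n+1}+a_{n-1}\psi_{n-1}+b_n\psi_n$ on $\{1,\ldots,N\}$ with $\psi_0=0$ and Dirichlet condition $\psi_{N+1}=0$. Let $\lambda_1,\ldots,\lambda_N$ be its (real, distinct) eigenvalues and let $\phi^k\in\mathbb{R}^N$ be the eigenvector for $\lambda_k$ normalized by $\phi^k_1=1$; put $\rho_k=(\phi^k,\phi^k)$. The spectral measure of $A^N$ is $d\rho^N$ with $\rho^N(\lambda)=\sum_{\{k:\lambda_k<\lambda\}}1/\rho_k$, i.e. mass $1/\rho_k$ at each $\lambda_k$ (total mass 1). $S^N_m$ is the $N\times N$ Hankel-type matrix with entries $(S^N_m)_{ij}=s_{2N-i-j+m}$, $i,j=1,\ldots,N$. *)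

(* Defs.v *)
From HB Require Import structures.
From mathcomp Require Import all_boot all_order all_algebra.
From mathcomp Require Import all_classical all_reals all_analysis.

Set Implicit Arguments.
Unset Strict Implicit.
Unset Printing Implicit Defensive.

Import Order.TTheory GRing.Theory Num.Theory.

Local Open Scope classical_set_scope.
Local Open Scope ring_scope.

Definition jacobi_mx (R : realType) (N : nat) (A : 'M[R]_N) : Prop :=
  [/\ A^T = A,
      forall i j : 'I_N, (i.+1 < j)%N -> A i j = 0 &
      forall i j : 'I_N, j = i.+1 :> nat -> 0 < A i j].

(* The sequence of the distinct eigenvalues of A. [eigenvalue] refers to row
   eigenvectors, but the eigenvalues are the same on either side. *)
Definition eigenvalues (R : realType) (N : nat) (A : 'M[R]_N) : seq R :=
  finmap.enum_fset (fset_set [set x : R | eigenvalue A x]).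

(* The eigenvector of A for x whose first entry is 1. For a Jacobi matrix with
   N > 0 and an eigenvalue x it exists and is unique; [xget] returns 0 when
   there is none. *)
Definition eigenvector1 (R : realType) (N : nat) (A : 'M[R]_N) (x : R) :
    'cV[R]_N :=
  xget 0 [set v : 'cV[R]_N |
    A *m v = x *: v /\ forall i : 'I_N, i = 0%N :> nat -> v i 0 = 1].

Definition sqnorm_eigenvector1 (R : realType) (N : nat) (A : 'M[R]_N) (x : R) :
    R :=
  \sum_(i < N) eigenvector1 A x i 0 ^+ 2.

Lemma spectral_mass_ge0 (R : realType) (N : nat) (A : 'M[R]_N) (x : R) :
  0 <= (sqnorm_eigenvector1 A x)^-1.
Proof. by rewrite invr_ge0; apply: sumr_ge0 => i _; exact: sqr_ge0. Qed.

(* [mscale] takes its coefficient in {nonneg R}. *)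
Definition spectral_mass (R : realType) (N : nat) (A : 'M[R]_N) (x : R) :
    {nonneg R} :=
  NngNum (spectral_mass_ge0 A x).

(* The distribution function in the usual definition, the sum of
   1 / sqnorm_eigenvector1 A x over the eigenvalues x < lambda, is the one of
   this sum of point masses. *)
Definition spectral_measure (R : realType) (N : nat) (A : 'M[R]_N) :
    {measure set (measurableTypeR R) -> \bar R} :=
  msum (fun k => let x := nth 0 (eigenvalues A) k in
                 mscale (spectral_mass A x) (dirac (x : measurableTypeR R)))
       (size (eigenvalues A)).

(* Rows and columns are numbered from 0 here, whence the successors; no
   subtraction is truncated, since i.+1 + j.+1 <= 2 * N. *)
Definition hankel_mx (R : realType) (N m : nat) (s : nat -> R) : 'M[R]_N :=
  \matrix_(i < N, j < N) s (2 * N - (i.+1 + j.+1) + m)%N.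

Definition posdef_mx (R : realType) (N : nat) (S : 'M[R]_N) : Prop :=
  S^T = S /\ forall v : 'cV[R]_N, v != 0 -> 0 < (v^T *m S *m v) 0 0.

(* Main.v *)
(* Expanding e_1 in the orthogonal eigenvectors phi^k shows that the moments of
   the spectral measure are the entries (A^m)_{11}. Up to reversing the order
   of rows and columns the Hankel matrix is H = (s_{i+j}), hence the Gram
   matrix of e_1, A e_1, ..., A^{N-1} e_1, which are linearly independent
   because A is tridiagonal with nonzero off-diagonal. Conversely, let
   H = L L^T be a Cholesky factorization and T = (s_{i+j+1}) the shifted
   Hankel matrix, the choice of its corner entry s_{2N-1} being free. Then
   A = L^{-1} T L^{-T} maps the i-th row of L to the (i+1)-st one; this makes
   A a Jacobi matrix and the rows of L the vectors e_1^T A^i, so that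
   s_{i+j} = (A^{i+j})_{11}. *)

Require Import Defs.
From HB Require Import structures.
From mathcomp Require Import all_boot all_order all_algebra.
From mathcomp Require Import all_classical all_reals all_analysis.
From mathcomp Require Import fingroup perm complex zify measurable_realfun.

Import Order.TTheory GRing.Theory Num.Theory.

Local Open Scope classical_set_scope.
Local Open Scope ring_scope.

Set Implicit Arguments.
Unset Strict Implicit.

(** * Diagonalization of real symmetric matrices *)

(** Over [R[i]] the matrix is hermitian, hence unitarily similar to a diagonal matrix with real
    entries. The minimal polynomial is invariant under similarity and field extension, so it already
    has simple roots, all of them in [R]. *)
Lemma symmetric_mxminpoly_split (R : rcfType) (n : nat) (A : 'M[R]_n.+1) :
  A^T = A ->
  exists2 rs : seq R, uniq rs & mxminpoly A = \prod_(r <- rs) ('X - r%:P).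
Proof.
move=> AT; pose f : {rmorphism R -> R[i]} := real_complex R.
have finj : injective f by exact: fmorph_inj.
pose B := map_mx f A.
have Breal : B \is a mxOver Num.real.
  by apply/mxOverP => i j; rewrite mxE; apply/complex_realP; exists (A i j).
have Bsym : B \is symmetricmx.
  by apply/is_hermitianmxP; rewrite expr0 scale1r map_mx_id // /B map_trmx AT.
have /orthomx_spectralP Beq := symmetric_normalmx Bsym Breal.
have /mxOverP Dreal := hermitian_spectral_diag_real (realsym_hermsym Bsym Breal).
pose d i : R := complex.Re (spectral_diag B 0 i).
have dE i : f (d i) = spectral_diag B 0 i by rewrite /d /f /= complex.RRe_real.
exists (undup [seq d i | i <- enum 'I_n.+1]); first exact: undup_uniq.
apply: (map_poly_inj f); rewrite -mxminpoly_map -/B Beq -conjVmx ?spectral_unit //.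
rewrite mxminpoly_uconj ?unitmx_inv ?spectral_unit //.
rewrite mxminpoly_diag rmorph_prod /=.
rewrite (eq_map (fun i => esym (dE i))) (map_comp f d) undup_map_inj // big_map.
by apply: eq_bigr => r _; rewrite map_polyXsubC.
Qed.

Lemma symmetric_diagonalizable (R : rcfType) (n : nat) (A : 'M[R]_n.+1) :
  A^T = A ->
  exists2 rs : seq R, uniq rs & (\sum_(r <- rs) eigenspace A r :=: 1%:M)%MS.
Proof.
move=> /symmetric_mxminpoly_split[rs rs_uniq Ars].
by apply/diagonalizablePeigen/diagonalizableP; exists rs => //; rewrite Ars.
Qed.

Lemma mem_eigenvalues (R : realType) (n : nat) (A : 'M[R]_n.+1) (x : R) :
  A^T = A -> (x \in eigenvalues A) = eigenvalue A x.
Proof.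
move=> /symmetric_mxminpoly_split[rs _ Ars].
(* [fset_set] is empty on an infinite set, so finiteness must be secured first. *)
have Afin : finite_set [set x | eigenvalue A x].
  apply: (sub_finite_set _ (finite_seq rs)) => y /=.
  by rewrite eigenvalue_root_min Ars root_prod_XsubC.
rewrite [LHS](in_fset_set Afin x).
by apply/idP/idP => [/set_mem|x_eig]; last exact/mem_set.
Qed.

Lemma symmetric_eigenspace_sum (R : realType) (n : nat) (A : 'M[R]_n.+1) :
  A^T = A ->
  (1%:M <= \sum_(k < size (eigenvalues A)) eigenspace A (nth 0 (eigenvalues A) k))%MS.
Proof.
move=> AT; have [rs _ <-] := symmetric_diagonalizable AT.
elim/big_ind: _ => [|B C sB sC|r _]; [exact: sub0mx|by rewrite addsmx_sub sB|].
have [r_eig|] := boolP (eigenvalue A r); last first.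
  by rewrite negbK => /eqP->; exact: sub0mx.
move: r_eig; rewrite -mem_eigenvalues // => r_eig.
have r_lt : (index r (eigenvalues A) < size (eigenvalues A))%N by rewrite index_mem.
by apply: (sumsmx_sup (Ordinal r_lt)); rewrite //= nth_index.
Qed.

(** * Integration against finitely many point masses *)

Lemma integral_msum_dirac (d : measure_display) (T : measurableType d)
    (R : realType) (c : nat -> {nonneg R}) (a : nat -> T) (n : nat) (f : T -> R) :
  measurable_fun setT f ->
  (\int[msum (fun k => mscale (c k) (dirac (a k))) n]_x (f x)%:E)%E =
  (\sum_(i < n) (c i)%:num * f (a i))%:E.
Proof.
(* For nonnegative functions the integral is additive in the measure; the general case follows by
   splitting [f] into positive and negative parts. *)
have ge0_part (g : T -> R) : measurable_fun setT g -> (forall x, 0 <= g x) ->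
    (\int[msum (fun k => mscale (c k) (dirac (a k))) n]_x (g x)%:E)%E =
    (\sum_(i < n) (c i)%:num * g (a i))%:E.
  move=> mg g0; have /measurable_EFinP mEg := mg.
  have Eg0 x : setT x -> (0 <= (EFin \o g) x)%E by rewrite lee_fin.
  rewrite (ge0_integral_measure_sum _ _ Eg0) // -sumEFin.
  apply: eq_bigr => i _; rewrite (ge0_integral_mscale _ _ _ _ Eg0) //.
  by rewrite integral_dirac //= diracT mul1e EFinM.
move=> mf; rewrite integralE (funerpos f) (funerneg f) /comp.
rewrite !ge0_part //; first last.
- exact: measurable_funrpos.
- exact: measurable_funrneg.
rewrite -EFinB -sumrB; congr (_%:E); apply: eq_bigr => i _.
by rewrite -mulrBr -[in RHS](congr1 (@^~ (a i)) (funrposBneg f)).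
Qed.

Lemma integral_spectral_measure (R : realType) (n : nat) (A : 'M[R]_n) (k : nat) :
  (\int[spectral_measure A]_x (x ^+ k)%:E)%E =
  (\sum_(i < size (eigenvalues A))
      (sqnorm_eigenvector1 A (nth 0 (eigenvalues A) i))^-1 *
      nth 0 (eigenvalues A) i ^+ k)%:E.
Proof.
rewrite /spectral_measure.
rewrite (integral_msum_dirac (fun j => spectral_mass A (nth 0 (eigenvalues A) j))
  (fun j => nth 0 (eigenvalues A) j : measurableTypeR R)) //.
Qed.

(** * Eigenvectors of a Jacobi matrix and the moments of its spectral measure *)

(** Row [m] of the eigenvalue equation expresses entry [m.+1] through earlier ones, since its
    coefficient is positive. This gives both the normalization of eigenvectors and the simplicity of
    eigenvalues. *)
Lemma jacobi_eigenvector_eq0 (R : realType) (n : nat) (A : 'M[R]_n.+1) (x : R)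
    (v : 'cV[R]_n.+1) :
  jacobi_mx A -> A *m v = x *: v -> v 0 0 = 0 -> v = 0.
Proof.
move=> [_ A0 Apos] Av v00.
suff v0 m : forall i : 'I_n.+1, (i <= m)%N -> v i 0 = 0.
  by apply/colP => i; rewrite mxE (v0 i).
elim: m => [i|m IHm i].
  by rewrite leqn0 => /eqP i0; rewrite (_ : i = 0) //; apply: val_inj.
rewrite leq_eqVlt => /orP[/eqP im|]; last exact: IHm.
have m_lt : (m < n.+1)%N by rewrite (leq_trans _ (ltn_ord i)) // im.
pose j := Ordinal m_lt.
have := congr1 (fun w : 'cV_n.+1 => w j 0) Av.
rewrite !mxE (IHm j) // mulr0 (bigD1 i) //= big1 => [/eqP|k ki].
  rewrite addr0 mulf_eq0 => /orP[|/eqP //].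
  by rewrite gt_eqF // Apos.
have [km|mk] := leqP k m; first by rewrite IHm ?mulr0.
by rewrite A0 ?mul0r //= ltn_neqAle mk -im andbT eq_sym.
Qed.

Lemma eigenvector1P (R : realType) (n : nat) (A : 'M[R]_n.+1) (x : R) :
  jacobi_mx A -> eigenvalue A x ->
  A *m eigenvector1 A x = x *: eigenvector1 A x /\ eigenvector1 A x 0 0 = 1.
Proof.
move=> jA /eigenvalueP[u uA u_neq0]; have [AT _ _] := jA.
have Au : A *m u^T = x *: u^T by rewrite -{1}AT -trmx_mul uA linearZ.
have u0 : u^T 0 0 != 0.
  apply: contraNneq u_neq0 => /(jacobi_eigenvector_eq0 jA Au) uT0.
  by rewrite -[u]trmxK uT0 trmx0.
set P := [set v : 'cV[R]_n.+1 |
    A *m v = x *: v /\ forall i : 'I_n.+1, i = 0%N :> nat -> v i 0 = 1].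
have [Aphi phi0] : P (eigenvector1 A x); last by split; rewrite // phi0.
apply: xgetPex; exists ((u^T 0 0)^-1 *: u^T); split.
  by rewrite -scalemxAr Au !scalerA mulrC.
by move=> i i0; rewrite mxE (_ : i = 0) ?mulVf //; apply: val_inj.
Qed.

Lemma dotmx_eigenvectors (R : fieldType) (n : nat) (A : 'M[R]_n) (x y : R)
    (v w : 'cV[R]_n) :
  A^T = A -> A *m v = x *: v -> A *m w = y *: w -> x != y -> v^T *m w = 0.
Proof.
move=> AT Av Aw xy; apply/eqP; apply: contraNT xy => vw_neq0.
have : x *: (v^T *m w) = y *: (v^T *m w).
  by rewrite [RHS]scalemxAr -Aw mulmxA -[in RHS]AT -trmx_mul Av linearZ -scalemxAl.
by move/eqP; rewrite -subr_eq0 -scalerBl scaler_eq0 (negPf vw_neq0) orbF subr_eq0.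
Qed.

Lemma sqnorm_eigenvector1E (R : realType) (n : nat) (A : 'M[R]_n) (x : R) :
  sqnorm_eigenvector1 A x = ((eigenvector1 A x)^T *m eigenvector1 A x) 0 0.
Proof. by rewrite mxE; apply: eq_bigr => i _; rewrite mxE -expr2. Qed.

Lemma jacobi_spectral_moment (R : realType) (n : nat) (A : 'M[R]_n.+1) (k : nat) :
  jacobi_mx A ->
  (\int[spectral_measure A]_x (x ^+ k)%:E)%E = ((A ^+ k) 0 0)%:E.
Proof.
move=> jA; have [AT _ _] := jA; rewrite integral_spectral_measure; congr (_%:E).
pose x (i : 'I_(size (eigenvalues A))) := nth 0 (eigenvalues A) i.
pose phi i := eigenvector1 A (x i).
have [Aphi phi0] : (forall i, A *m phi i = x i *: phi i) /\ forall i, phi i 0 0 = 1.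
  have x_eig i : eigenvalue A (x i) by rewrite -mem_eigenvalues ?mem_nth.
  by split=> i; have [] := eigenvector1P jA (x_eig i).
have x_inj i j : x i = x j -> i = j.
  by move/eqP; rewrite nth_uniq // => [/eqP/val_inj|]; last exact: finmap.fset_uniq.
have Akphi i : A ^+ k *m phi i = x i ^+ k *: phi i.
  elim: k => [|m IHm]; first by rewrite !expr0 mul1mx scale1r.
  by rewrite exprS -mulmxA IHm -scalemxAr Aphi scalerA -exprSr.
have /sub_sumsmxP[u e0E] : ((delta_mx 0 0 : 'rV[R]_n.+1) <=
    \sum_(i < size (eigenvalues A)) eigenspace A (x i))%MS.
  exact: submx_trans (submx1 _) (symmetric_eigenspace_sum AT).
(* The component of the first basis vector in the [i]-th eigenspace. *)
pose w i := (u i *m eigenspace A (x i))^T.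
have Aw i : A *m w i = x i *: w i.
  have /eigenspaceP wA : (u i *m eigenspace A (x i) <= eigenspace A (x i))%MS.
    exact: submxMl.
  by rewrite -{1}AT -trmx_mul wA linearZ.
(* The difference of the two sides is an eigenvector with first entry 0. *)
have w_phi i : w i = w i 0 0 *: phi i.
  apply/eqP; rewrite -subr_eq0; apply/eqP.
  apply: (jacobi_eigenvector_eq0 jA (x := x i)).
    by rewrite mulmxBr -scalemxAr Aw Aphi scalerBr !scalerA mulrC.
  by rewrite !mxE phi0 mulr1 subrr.
have e0_phi : delta_mx 0 0 = \sum_i w i 0 0 *: phi i :> 'cV[R]_n.+1.
  rewrite -[LHS]trmxK trmx_delta e0E linear_sum /=.
  by apply: eq_bigr => i _; rewrite -w_phi.
(* Pair the expansion [e0_phi] with [phi i]: orthogonality leaves one term, and the left side is the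
   first entry of [phi i], which is 1. *)
have coef i : w i 0 0 = (sqnorm_eigenvector1 A (x i))^-1.
  have : (delta_mx 0 0 : 'rV_n.+1) *m phi i = w i 0 0 *: ((phi i)^T *m phi i).
    rewrite -trmx_delta e0_phi linear_sum mulmx_suml (bigD1 i) //= linearZ -scalemxAl.
    rewrite big1 ?addr0 // => j ji; rewrite linearZ -scalemxAl.
    rewrite (dotmx_eigenvectors AT (Aphi j) (Aphi i)) ?scaler0 //.
    by apply: contraNneq ji => /x_inj ->.
  move/(congr1 (fun M : 'M[R]_1 => M 0 0)).
  rewrite -rowE [RHS]mxE -sqnorm_eigenvector1E mxE phi0 mulrC => /esym.
  by move/mulr1_eq.
transitivity ((A ^+ k *m (delta_mx 0 0 : 'cV_n.+1)) 0 0); last by rewrite -colE mxE.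
rewrite e0_phi mulmx_sumr summxE; apply: eq_bigr => i _.
by rewrite -scalemxAr Akphi coef !mxE phi0 mulr1.
Qed.

(** * Positive definite matrices and Cholesky factorization *)

Lemma posdef_congr (R : realType) (n : nat) (S P : 'M[R]_n) :
  P \in unitmx -> posdef_mx S -> posdef_mx (P^T *m S *m P).
Proof.
move=> P_unit [ST Spos]; split=> [|v v_neq0].
  by rewrite !trmx_mul trmxK ST mulmxA.
have Pv_neq0 : P *m v != 0.
  by apply: contraNneq v_neq0 => Pv0; rewrite -[v](mulKmx P_unit) Pv0 mulmx0.
by have := Spos _ Pv_neq0; rewrite trmx_mul !mulmxA.
Qed.

Lemma posdef_mx1 (R : realType) (n : nat) : posdef_mx (1%:M : 'M[R]_n).
Proof.
split=> [|v v_neq0]; first exact: trmx1.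
rewrite mulmx1 mxE; under eq_bigr => i _ do rewrite mxE -expr2.
rewrite lt_def sumr_ge0 ?andbT; last by move=> i _; exact: sqr_ge0.
apply: contra v_neq0; rewrite psumr_eq0 => [/allP v0|i _]; last exact: sqr_ge0.
apply/eqP/colP => i; rewrite mxE; apply/eqP.
by have := v0 i (mem_index_enum _); rewrite sqrf_eq0.
Qed.

Lemma trig_unitmx (R : numFieldType) (n : nat) (L : 'M[R]_n) :
  is_trig_mx L -> (forall i, 0 < L i i) -> L \in unitmx.
Proof.
move=> L_trig L_pos; rewrite unitmxE unitfE det_trig //.
by rewrite gt_eqF // prodr_gt0.
Qed.

(** Induction through the Schur complement of the upper left entry [a]: it is again positive
    definite, and its factor is bordered by the column made of the square root of [a] and [b^T]
    divided by that root. *)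
Lemma posdef_cholesky (R : realType) (n : nat) (S : 'M[R]_n) :
  posdef_mx S ->
  exists L : 'M[R]_n, [/\ is_trig_mx L, forall i, 0 < L i i & S = L *m L^T].
Proof.
elim: n S => [S _|n IHn].
  by exists 0; split; [exact: mx0_is_trig|case|apply/matrixP; case].
rewrite -[n.+1]/(1 + n)%N => S.
rewrite -[S]submxK; move: (ulsubmx S) (ursubmx S) (dlsubmx S) (drsubmx S).
move=> {S} a b c C [/eqP]; rewrite tr_block_mx => /eqP/eq_block_mx[_ _ <- CT Spos].
have a_gt0 : 0 < a 0 0.
  have := Spos (col_mx 1 0); rewrite tr_col_mx trmx0 trmx1 mul_row_block.
  rewrite !mul0mx !addr0 mul_row_col mulmx0 addr0 mulmx1 mul1mx; apply.
  apply/eqP => /(congr1 usubmx); rewrite col_mxKu linear0 => /matrixP/(_ 0 0)/eqP.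
  by rewrite !mxE oner_eq0.
have aE : a = (a 0 0)%:M by exact: mx11_scalar.
have Cb_pos : posdef_mx (C - (a 0 0)^-1 *: (b^T *m b)).
  split=> [|v v_neq0].
    by rewrite linearB linearZ /= trmx_mul trmxK CT.
  (* For fixed [v], this first entry minimizes the quadratic form; the minimum is the value of the
     Schur complement at [v]. *)
  have := Spos (col_mx (- (a 0 0)^-1 *: (b *m v)) v).
  rewrite tr_col_mx mul_row_block mul_row_col.
  set z := _ + v^T *m b^T; have -> : z = 0.
    rewrite /z {2}aE mul_mx_scalar linearZ /= scalerA mulrN mulfV ?gt_eqF //.
    by rewrite scaleN1r trmx_mul addNr.
  rewrite mul0mx add0r mulmxBr linearZ /= trmx_mul addrC.
  rewrite -scalemxAl -scalemxAr !scaleNr !mulmxA; apply.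
  by apply: contraNneq v_neq0 => /(congr1 dsubmx); rewrite col_mxKd linear0 => ->.
have [L [L_trig L_pos LE]] := IHn _ Cb_pos.
pose r := Num.sqrt (a 0 0).
have r_gt0 : 0 < r by rewrite sqrtr_gt0.
have rr : r * r = a 0 0 by rewrite -expr2 sqr_sqrtr // ltW.
exists (block_mx r%:M 0 (r^-1 *: b^T) L); split.
- by rewrite is_trig_block_mx // eqxx /= L_trig andbT scalar_mx_is_trig.
- move=> i; rewrite -(splitK i); case: (fintype.split i) => j /=.
    by rewrite block_mxEul mxE eqxx.
  by rewrite block_mxEdr.
- rewrite tr_block_mx mulmx_block trmx0 !mul0mx !mulmx0 !addr0.
  rewrite tr_scalar_mx linearZ /= trmxK -LE.
  congr block_mx.
  + by rewrite mul_mx_scalar scale_scalar_mx rr -aE.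
  + by rewrite mul_scalar_mx scalerA mulfV ?scale1r // gt_eqF.
  + by rewrite mul_mx_scalar scalerA mulfV ?scale1r // gt_eqF.
  + by rewrite -scalemxAl -scalemxAr scalerA -invfM rr addrC subrK.
Qed.

(** * Hankel matrices in increasing order of indices *)

Definition moment_mx (R : realType) (n : nat) (s : nat -> R) : 'M[R]_n :=
  \matrix_(i < n, j < n) s (i + j)%N.

(** Reversal of the indices is an involution, so each matrix is congruent to the other through the
    same permutation matrix. *)
Lemma posdef_hankel_moment (R : realType) (n : nat) (s : nat -> R) :
  posdef_mx (hankel_mx n 0 s) <-> posdef_mx (moment_mx n s).
Proof.
pose r : 'S_n := perm (@rev_ord_inj n).
have rV : r^-1%g = r.
  apply/eqP; rewrite eq_invg_mul; apply/eqP/permP => i.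
  by rewrite perm1 permM !permE rev_ordK.
have rev_congr (S : 'M[R]_n) :
    (perm_mx r)^T *m S *m perm_mx r = \matrix_(i, j) S (rev_ord i) (rev_ord j).
  rewrite tr_perm_mx rV -row_permE -{2}[r]rV -col_permE.
  by apply/matrixP => i j; rewrite !mxE !permE.
have hankelE : hankel_mx n 0 s = (perm_mx r)^T *m moment_mx n s *m perm_mx r.
  rewrite rev_congr; apply/matrixP => i j; rewrite !mxE; congr s => /=.
  by have := ltn_ord i; have := ltn_ord j; lia.
have momentE : moment_mx n s = (perm_mx r)^T *m hankel_mx n 0 s *m perm_mx r.
  rewrite rev_congr; apply/matrixP => i j; rewrite !mxE; congr s => /=.
  by have := ltn_ord i; have := ltn_ord j; lia.
by split => ?; [rewrite momentE|rewrite hankelE]; apply: posdef_congr => //;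
  exact: unitmx_perm.
Qed.

(** * From a Jacobi matrix to a positive definite moment matrix *)

Lemma trmx_exp (R : comNzRingType) (n : nat) (A : 'M[R]_n.+1) (k : nat) :
  A^T = A -> (A ^+ k)^T = A ^+ k.
Proof.
move=> AT; elim: k => [|k IHk]; first by rewrite expr0 trmx1.
by rewrite exprSr trmx_mul IHk AT -exprSr exprS.
Qed.

Lemma symmetric_exp00 (R : comNzRingType) (n : nat) (A : 'M[R]_n.+1) (i j : nat) :
  A^T = A ->
  (A ^+ (i + j)) 0 0 = \sum_k (A ^+ i) 0 k * (A ^+ j) 0 k.
Proof.
move=> AT; rewrite exprD mxE; apply: eq_bigr => k _; congr (_ * _).
by rewrite -[in LHS](trmx_exp j AT) mxE.
Qed.

(** Each factor [A] moves at most one column to the right, and entry [k] of the first row of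
    [A ^+ k] is the product of the first [k] off-diagonal entries. *)
Lemma jacobi_exp_trig (R : realType) (n : nat) (A : 'M[R]_n.+1) (k : nat) :
  jacobi_mx A ->
  (forall j : 'I_n.+1, (k < j)%N -> (A ^+ k) 0 j = 0) /\
  (forall j : 'I_n.+1, j = k :> nat -> 0 < (A ^+ k) 0 j).
Proof.
move=> [_ A0 Apos]; elim: k => [|k [IH0 IHpos]].
  split=> j; rewrite expr0 mxE; first by case: j => [[|j] ?].
  by move=> j0; rewrite (_ : j = 0) ?eqxx //; apply: val_inj.
split=> j kj; rewrite exprSr mxE.
  rewrite big1 // => l _; have [lk|kl] := leqP l k; last by rewrite IH0 ?mul0r.
  by rewrite A0 ?mulr0 // (leq_ltn_trans _ kj).
have k_lt : (k < n.+1)%N by have := ltn_ord j; rewrite kj; exact: ltnW.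
rewrite (bigD1 (Ordinal k_lt)) //= big1 => [|l lk].
  by rewrite addr0 mulr_gt0 // ?IHpos // Apos.
have [kl|kl|kl] := ltngtP l k.
- by rewrite A0 ?mulr0 // kj ltnS.
- by rewrite IH0 ?mul0r.
- by case/eqP: lk; apply: val_inj.
Qed.

Lemma jacobi_posdef_moment (R : realType) (n : nat) (A : 'M[R]_n.+1)
    (s : nat -> R) :
  jacobi_mx A -> (forall k, (k <= 2 * n)%N -> s k = (A ^+ k) 0 0) ->
  posdef_mx (moment_mx n.+1 s).
Proof.
move=> jA sE; have [AT _ _] := jA.
pose L := \matrix_(i < n.+1, j < n.+1) (A ^+ i) 0 j.
have L_unit : L \in unitmx.
  apply: trig_unitmx => [|i]; last by rewrite mxE; apply (jacobi_exp_trig i jA).2.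
  by apply/is_trig_mxP => i j ij; rewrite mxE; apply (jacobi_exp_trig i jA).1.
have -> : moment_mx n.+1 s = L^T^T *m 1%:M *m L^T.
  rewrite trmxK mulmx1; apply/matrixP => i j; rewrite !mxE.
  rewrite sE ?symmetric_exp00 //; first by apply: eq_bigr => k _; rewrite !mxE.
  by have := ltn_ord i; have := ltn_ord j; lia.
by apply: posdef_congr; [rewrite unitmx_tr|exact: posdef_mx1].
Qed.

(** * From a positive definite moment matrix to a Jacobi matrix *)

Lemma posdef_moment_jacobi (R : realType) (n : nat) (s : nat -> R) :
  s 0%N = 1 -> posdef_mx (moment_mx n.+1 s) ->
  exists A : 'M[R]_n.+1,
    jacobi_mx A /\ forall k, (k <= 2 * n)%N -> (A ^+ k) 0 0 = s k.
Proof.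
move=> s0 /posdef_cholesky[L [L_trig L_pos LE]].
have L_unit := trig_unitmx L_trig L_pos.
have /is_trig_mxP L0 := L_trig.
(* The corner entry [s (2 * n).+1] lies beyond the prescribed moments; [LA] below compares only the
   rows above it. *)
pose T := \matrix_(i < n.+1, j < n.+1) s (i + j).+1.
pose A := invmx L *m T *m invmx L^T.
have AT : A^T = A.
  rewrite /A !trmx_mul !trmx_inv trmxK mulmxA; congr (_ *m _ *m _).
  by apply/matrixP => i j; rewrite !mxE addnC.
(* [L *m A] equals [T *m invmx L^T], and row [i] of [T] is row [i.+1] of the moment matrix
   [L *m L^T]. *)
have LA (i i' j : 'I_n.+1) : i' = i.+1 :> nat -> (L *m A) i j = L i' j.
  move=> ii'; have -> : L i' j = (moment_mx n.+1 s *m invmx L^T) i' j.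
    by rewrite LE mulmxK ?unitmx_tr.
  rewrite /A -mulmxA mulKVmx // !mxE; apply: eq_bigr => k _.
  by rewrite !mxE ii' addSn.
clearbody A.
(* In row [i] of [L *m A], triangularity of [L] removes the terms after the diagonal one, and the
   assumption on column [j] those before it. *)
have LA_sum (i i' j : 'I_n.+1) : i' = i.+1 :> nat ->
    (forall k : 'I_n.+1, (k < i)%N -> A k j = 0) -> L i i * A i j = L i' j.
  move=> ii' A0; rewrite -(LA i i') // mxE (bigD1 i) //= big1 ?addr0 // => k ki.
  have [lt_ki|lt_ik|/val_inj eq_ki] := ltngtP k i.
  - by rewrite A0 ?mulr0.
  - by rewrite L0 ?mul0r.
  - by rewrite eq_ki eqxx in ki.
have A0 (i j : 'I_n.+1) : (i.+1 < j)%N -> A i j = 0.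
  have [m] := ubnP i; elim: m i => // m IHm i im ij.
  have i_lt : (i.+1 < n.+1)%N by exact: leq_trans (ltnW ij) (ltn_ord j).
  apply: (mulfI (lt0r_neq0 (L_pos i))); rewrite mulr0.
  rewrite (LA_sum i (Ordinal i_lt)) // ?L0 // => k ki.
  by rewrite IHm //; [exact: leq_trans ki _|exact: leq_ltn_trans ki (ltnW ij)].
have Apos (i j : 'I_n.+1) : j = i.+1 :> nat -> 0 < A i j.
  move=> ij; rewrite -(pmulr_rgt0 _ (L_pos i)) (LA_sum i j) // => k ki.
  by rewrite A0 // ij ltnS.
have LAk k : forall i j : 'I_n.+1, i = k :> nat -> (A ^+ k) 0 j = L i j.
  elim: k => [i j i0|k IHk i j ik].
    rewrite expr0 (_ : i = 0); last exact: val_inj.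
    rewrite mxE; have [<-|j_neq0] := eqVneq 0 j; last first.
      by rewrite L0 // lt0n eq_sym.
    (* The corner of [LE] reads [L 0 0 ^+ 2 = s 0 = 1], and positivity selects the root 1. *)
    have := congr1 (fun M : 'M[R]_n.+1 => M 0 0) LE; rewrite !mxE s0 big_ord_recl.
    rewrite big1 ?addr0 => [|l _]; last by rewrite L0 ?mul0r.
    rewrite mxE -expr2 => /esym/eqP; rewrite sqrf_eq1 => /orP[/eqP ->//|/eqP L00].
    by have := L_pos 0; rewrite L00 oppr_gt0 ltr10.
  have k_lt : (k < n.+1)%N by have := ltn_ord i; rewrite ik; exact: ltnW.
  rewrite -(LA (Ordinal k_lt) i) // exprSr !mxE; apply: eq_bigr => l _.
  by rewrite (IHk (Ordinal k_lt)).
exists A; split=> // k k_le.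
(* As [k] is at most [2 * n], it is a sum of two indices at most [n], which locates [s k] in the
   moment matrix. *)
have i_lt : (minn k n < n.+1)%N by lia.
have j_lt : (k - minn k n < n.+1)%N by lia.
have -> : k = (Ordinal i_lt + Ordinal j_lt)%N by rewrite /=; lia.
rewrite symmetric_exp00 //.
have := congr1 (fun M : 'M[R]_n.+1 => M (Ordinal i_lt) (Ordinal j_lt)) LE.
rewrite [in X in X -> _]mxE => ->; rewrite mxE; apply: eq_bigr => l _.
by rewrite mxE (LAk _ (Ordinal i_lt)) // (LAk _ (Ordinal j_lt)).
Qed.

Unset Implicit Arguments.
Set Strict Implicit.

Theorem proposition7 (R : realType) (N : nat) (N_gt0 : (0 < N)%N)
    (s : nat -> R) (s0 : s 0%N = 1) :
  (exists A : 'M[R]_N, jacobi_mx A /\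
     forall k : nat, (k <= 2 * N - 2)%N ->
       (s k)%:E = (\int[spectral_measure A]_x (x ^+ k)%:E)%E)
  <-> posdef_mx (hankel_mx N 0 s).
Proof.
case: N N_gt0 => // n _; rewrite posdef_hankel_moment.
have -> : (2 * n.+1 - 2 = 2 * n)%N by lia.
split=> [[A [jA sE]]|/(posdef_moment_jacobi s0)[A [jA AE]]].
  apply: (jacobi_posdef_moment jA) => k /sE.
  by rewrite jacobi_spectral_moment // => -[].
by exists A; split=> // k k_le; rewrite jacobi_spectral_moment // AE.
Qed.
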